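(* Let $f_1,\dots,f_m:\mathbb{R}^n\to\mathbb{R}$ be convex functions and let $X_1,\dots,X_m\subseteq\mathbb{R}^n$ be closed convex sets with intersection $X=\bigcap_{i=1}^m X_i$. Assume: (i) there are a vector $\bar x\in\mathbb{R}^n$ and a scalar $\delta>0$ such that $\{z\mid\|z-\bar x\|\le\delta\}\subset X$; (ii) each $X_i$ is compact, i.e., there is a scalar $B>0$ such that $\|x\|\le B$ for all $x\in X_i$ and all $i$. Let $\{x^i(k)\}$, $i=1,\dots,m$, be the iterates generated by the projected subgradient algorithm $$v^i(k)=\sum_{j=1}^m a^i_j(k)x^j(k),\qquad x^i(k+1)=P_{X_i}\big[v^i(k)-\alpha_k d_i(k)\big],\qquad k\ge0,$$ with $x^i(0)\in X_i$, $d_i(k)\in\partial f_i(v^i(k))$, weight vectors $a^i(k)=(a^i_1(k),\dots,a^i_m(k))'=(1/m,\dots,1/m)'$ for all $i$ and $k$, and stepsizes $\alpha_k>0$ satisfying $\sum_k\alpha_k=\infty$ and $\sum_k\alpha_k^2<\infty$. Then the sequences $\{x^i(k)\}$, $i=1,\dots,m$, converge to the same optimal point, i.e., $$\lim_{k\to\infty}x^i(k)=x^*\qquad\text{for some } x^*\in X^* \text{ and all } i,$$ where $X^*$ is the set of optimal solutions of the problem of minimizing $\sum_{i=1}^m f_i(x)$ subject to $x\in X$.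
   Context: $\|\cdot\|$ is the Euclidean norm and $P_C[z]$ is the Euclidean projection of $z$ on a closed convex set $C$. For a convex function $F:\mathbb{R}^n\to\mathbb{R}$, $\partial F(\bar x)$ is the set of subgradients of $F$ at $\bar x$, i.e. vectors $s$ with $F(\bar x)+s'(x-\bar x)\le F(x)$ for all $x\in\mathbb{R}^n$. *)

(* Defs.v *)
From HB Require Import structures.
From mathcomp Require Export all_boot all_order all_algebra.
From mathcomp Require Export all_classical all_reals all_analysis.

Set Implicit Arguments.
Unset Strict Implicit.
Unset Printing Implicit Defensive.

Export Order.TTheory GRing.Theory Num.Theory.
Export numFieldNormedType.Exports.

Local Open Scope classical_set_scope.
Local Open Scope ring_scope.

(* Vectors of R^n are row vectors. The library norm `|x| on
   'rV[R]_n is the sup norm, so the Euclidean norm is defined here; both induce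
   the library's (product) topology of 'rV[R]_n, which is the one used for
   closedness of sets and for limits of sequences of vectors. *)

Definition dotv (R : realType) (n : nat) (u v : 'rV[R]_n) : R :=
  \sum_(j < n) u ord0 j * v ord0 j.

Definition enorm (R : realType) (n : nat) (u : 'rV[R]_n) : R :=
  Num.sqrt (\sum_(j < n) u ord0 j ^+ 2).

Definition subdifferential (R : realType) (n : nat) (F : 'rV[R]_n -> R)
    (xbar : 'rV[R]_n) : set 'rV[R]_n :=
  [set s | forall x : 'rV[R]_n, F xbar + dotv s (x - xbar) <= F x].

(* The set of Euclidean-nearest points is a singleton when C is nonempty, closed
   and convex; xget picks that point. The default value 0 only matters when no
   nearest point exists. *)
Definition proj (R : realType) (n : nat) (C : set 'rV[R]_n)
    (z : 'rV[R]_n) : 'rV[R]_n :=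
  xget 0 [set p | C p /\ forall q, C q -> enorm (z - p) <= enorm (z - q)].

Definition minimizers (R : realType) (n : nat) (F : 'rV[R]_n -> R)
    (X : set 'rV[R]_n) : set 'rV[R]_n :=
  [set x | X x /\ forall y, X y -> F x <= F y].

(* Main.v *)
Require Import Defs.
From mathcomp Require Import ring lra.

Set Implicit Arguments.
Unset Strict Implicit.

Local Open Scope classical_set_scope.
Local Open Scope ring_scope.

(* With uniform weights every agent evaluates its subgradient at the same mean
   point [y k].  Put [W z k = sum_i |x i k - z|^2 = m |y k - z|^2 + V k], where
   [V k = sum_i |x i k - y k|^2].  For an optimal [z] the projection step gives
     [W z k.+1 <= W z k - V k - 2 alpha k (F (y k) - F z) + L (alpha k)^2].
   As [y k] may be infeasible, [F (y k) - F z] may be negative; but moving [y k]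
   towards the interior point [xbar] by a fraction of order [eps k = sqrt (V k)]
   makes it feasible, so [F (y k) - F z >= - C eps k], and the resulting cross
   term [2 alpha k C eps k] is absorbed by [V k] and [(alpha k)^2].  Hence
     [W z k.+1 <= W z k - alpha k G k + c (alpha k)^2]
   with [G k] controlling both [V k] and [F (y k) - F z].  Since the stepsizes
   are not summable, [G k] is small infinitely often, and a cluster point [xs] of
   the [y k] along such indices is feasible and optimal.  The inequality for
   [z = xs] then turns [W xs k] being small infinitely often into [W xs k -> 0]. *)

(** * Euclidean inner product and its comparison with the sup norm *)

Section Dot.
Variables (R : realType) (n : nat).
Implicit Types u v w : 'rV[R]_n.

Lemma dotvC u v : dotv u v = dotv v u.
Proof. by apply: eq_bigr => j _; rewrite mulrC. Qed.

Lemma dotvDr u v w : dotv u (v + w) = dotv u v + dotv u w.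
Proof. by rewrite -big_split; apply: eq_bigr => j _; rewrite mxE mulrDr. Qed.

Lemma dotvZr (c : R) u v : dotv u (c *: v) = c * dotv u v.
Proof. by rewrite big_distrr; apply: eq_bigr => j _ /=; rewrite mxE mulrCA. Qed.

Lemma dotvBr u v w : dotv u (v - w) = dotv u v - dotv u w.
Proof. by rewrite dotvDr -scaleN1r dotvZr mulN1r. Qed.

Lemma dotv0r u : dotv u 0 = 0.
Proof. by rewrite -(scale0r 0) dotvZr mul0r. Qed.

Lemma dotv_sumr u (I : Type) (r : seq I) (F : I -> 'rV[R]_n) :
  dotv u (\sum_(i <- r) F i) = \sum_(i <- r) dotv u (F i).
Proof.
by elim/big_rec2: _ => [|i y z _ <-]; [exact: dotv0r | exact: dotvDr].
Qed.

Lemma dotvv_ge0 u : 0 <= dotv u u.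
Proof. by apply: sumr_ge0 => j _; rewrite -expr2 sqr_ge0. Qed.

Lemma enormE u : enorm u = Num.sqrt (dotv u u).
Proof. by congr Num.sqrt; apply: eq_bigr => j _; rewrite expr2. Qed.

Lemma ler_enorm u v : (enorm u <= enorm v) = (dotv u u <= dotv v v).
Proof. by rewrite !enormE ler_sqrt// dotvv_ge0. Qed.

Lemma enorm_le (r : R) u : 0 <= r -> (enorm u <= r) = (dotv u u <= r ^+ 2).
Proof.
by move=> r0; rewrite enormE -{1}(ger0_norm r0) -sqrtr_sqr ler_sqrt// sqr_ge0.
Qed.

Lemma dotvvDZ (c : R) u v :
  dotv (u + c *: v) (u + c *: v) =
  dotv u u + 2 * c * dotv u v + c ^+ 2 * dotv v v.
Proof.
rewrite dotvDr dotvZr !(dotvC (u + _)) !dotvDr !dotvZr (dotvC v u).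
ring.
Qed.

Lemma dotvvB u v :
  dotv (u - v) (u - v) = dotv u u - 2 * dotv u v + dotv v v.
Proof. by rewrite -scaleN1r dotvvDZ; ring. Qed.

Lemma dotvvZ (c : R) u : dotv (c *: u) (c *: u) = c ^+ 2 * dotv u u.
Proof. by rewrite dotvZr dotvC dotvZr mulrA. Qed.

Lemma dotvvN u v : dotv (u - v) (u - v) = dotv (v - u) (v - u).
Proof. by rewrite !dotvvB (dotvC v u); ring. Qed.

Lemma coord_le_norm u (j : 'I_n) : `|u ord0 j| <= `|u|.
Proof.
rewrite [leRHS]/Num.Def.normr /= mx_normrE.
by rewrite (le_bigmax _ (fun ij : 'I_1 * 'I_n => `|u ij.1 ij.2|) (ord0, j)).
Qed.

Lemma norm_le_coord (r : R) u :
  0 <= r -> (forall j, `|u ord0 j| <= r) -> `|u| <= r.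
Proof.
move=> r0 ur; rewrite [leLHS]/Num.Def.normr /= mx_normrE bigmax_le// => -[i j] _ /=.
by rewrite ord1.
Qed.

(** Passes from Euclidean bounds to the sup norm, in which balls and limits are expressed. *)
Lemma norm_le_dotvv (r : R) u : 0 <= r -> dotv u u <= r ^+ 2 -> `|u| <= r.
Proof.
move=> r0 ur; apply: norm_le_coord => // j.
rewrite -ler_sqr ?nnegrE// real_normK ?num_real//; apply: le_trans ur.
rewrite /dotv (bigD1 j)//= -expr2 lerDl sumr_ge0// => i _.
by rewrite -expr2 sqr_ge0.
Qed.

Lemma dotvv_le_norm u : dotv u u <= n%:R * `|u| ^+ 2.
Proof.
rewrite /dotv -[X in X%:R]card_ord mulr_natl -sumr_const ler_sum// => j _.
by rewrite -expr2 -real_normK ?num_real// ler_sqr ?nnegrE// coord_le_norm.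
Qed.

(* Huygens' formula: the cross terms vanish because the [u i - y] sum to 0. *)
Lemma sum_dotvv_mean (m : nat) (u : 'I_m -> 'rV[R]_n) y z :
  m%:R *: y = \sum_i u i ->
  \sum_i dotv (u i - z) (u i - z) =
  m%:R * dotv (y - z) (y - z) + \sum_i dotv (u i - y) (u i - y).
Proof.
move=> yE.
have -> : m%:R * dotv (y - z) (y - z) = \sum_(i < m) dotv (y - z) (y - z).
  by rewrite sumr_const card_ord mulr_natl.
rewrite -big_split /=; apply/eqP; rewrite -subr_eq0 -sumrB; apply/eqP.
have E i : dotv (u i - z) (u i - z) -
    (dotv (y - z) (y - z) + dotv (u i - y) (u i - y)) =
    2 * dotv (y - z) (u i - y).
  rewrite !dotvvB !dotvBr !(dotvC (y - z)) !dotvBr.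
  by ring.
under eq_bigr => i _ do rewrite E.
rewrite -mulr_sumr -dotv_sumr sumrB -yE sumr_const card_ord.
by rewrite scaler_nat subrr dotv0r mulr0.
Qed.

End Dot.

(** * Series with nonnegative terms *)

Section Sequences.
Variable R : realType.
Implicit Types a g : nat -> R.

Lemma partial_sum_le a : (forall k, 0 <= a k) ->
  (\sum_(0 <= k <oo) (a k)%:E < +oo)%E ->
  exists2 S : R, 0 <= S & forall K, \sum_(0 <= k < K) a k <= S.
Proof.
move=> a0 afin.
have le k : ((\sum_(0 <= i < k) a i)%:E <= \sum_(0 <= k <oo) (a k)%:E)%E.
  rewrite -sumEFin; apply: (@nneseries_lim_ge _ (fun i => (a i)%:E) xpredT) => i _ _.
  by rewrite lee_fin.
exists (fine (\sum_(0 <= k <oo) (a k)%:E)%E).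
  by apply/fine_ge0/nneseries_ge0 => i _ _; rewrite lee_fin.
move=> K; rewrite -lee_fin fineK// fin_numElt afin andbT.
by rewrite (lt_le_trans _ (le 0%N))// ltNyr.
Qed.

Lemma partial_sum_unbounded a : (forall k, 0 <= a k) ->
  (\sum_(0 <= k <oo) (a k)%:E = +oo)%E ->
  forall S : R, exists K, S < \sum_(0 <= k < K) a k.
Proof.
move=> a0 ainf S; apply/not_existsP => H.
have : (\sum_(0 <= k <oo) (a k)%:E <= S%:E)%E.
  apply: lime_le.
    by apply: is_cvg_nneseries => i _ _; rewrite lee_fin.
  by apply: nearW => K; rewrite sumEFin lee_fin leNgt; apply/negP/H.
by rewrite ainf leye_eq.
Qed.

(** A finite block is at most the whole remainder from [M], which tends to 0; hence the uniformity
    in [K]. *)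
Lemma tail_sum_small a : (forall k, 0 <= a k) ->
  (\sum_(0 <= k <oo) (a k)%:E < +oo)%E ->
  forall e : R, 0 < e ->
  exists N, forall M K, (N <= M)%N -> \sum_(M <= k < K) a k <= e.
Proof.
move=> a0 afin e e0.
have a0E k : (0 <= (a k)%:E)%E by rewrite lee_fin.
have := @nneseries_tail_cvg _ (fun k => (a k)%:E) xpredT afin (fun k _ => a0E k).
move=> /fine_cvgP[fin /cvgrPdist_le/(_ e e0) small].
have [N _ HN] := filterI fin small.
exists N => M K NM; have [/= finM] := HN M NM.
rewrite sub0r normrN => /(le_trans (ler_norm _)).
apply: le_trans; rewrite -lee_fin fineK// -sumEFin.
exact: (@nneseries_lim_ge _ (fun i => (a i)%:E) xpredT).
Qed.

(** If [g] stayed above [e] from [N] on, the weights past [N] would sum to at most [S / e]. *)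
Lemma weighted_sum_frequently_small a g (S : R) :
  (forall k, 0 <= a k) -> (forall K, exists K', K < \sum_(0 <= k < K') a k) ->
  (forall k, 0 <= g k) -> (forall K, \sum_(0 <= k < K) a k * g k <= S) ->
  forall (e : R) N, 0 < e -> exists2 k, (N <= k)%N & g k < e.
Proof.
move=> a0 ainf g0 agS e N e0; apply: contrapT => H.
have ge k : (N <= k)%N -> e <= g k.
  by move=> Nk; rewrite leNgt; apply/negP => gke; apply: H; exists k.
have bd K : \sum_(0 <= k < K) a k <= \sum_(0 <= k < N) a k + S / e.
  have [KN|/ltnW NK] := leqP K N.
    have S0 : 0 <= S by move: (agS 0%N); rewrite big_geq.
    rewrite (big_cat_nat (leq0n _) KN)//= -addrA lerDl addr_ge0//.
      by apply: sumr_ge0.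
    by rewrite divr_ge0// ltW.
  rewrite (big_cat_nat (leq0n _) NK)//= lerD2l ler_pdivlMr// mulr_suml.
  apply: le_trans (agS K); rewrite [leRHS](big_cat_nat (leq0n _) NK)//= -[leLHS]add0r.
  rewrite lerD//; first by apply: sumr_ge0 => k _; rewrite mulr_ge0.
  rewrite big_nat_cond [leRHS]big_nat_cond ler_sum// => k /andP[/andP[Nk _] _].
  by rewrite ler_wpM2l// ge.
by have [K'] := ainf (\sum_(0 <= k < N) a k + S / e); rewrite ltNge bd.
Qed.

(* Up to a summable error [w] is nonincreasing: once small, at a late enough
   index, it stays small. *)
Lemma quasi_decreasing_cvg0 a (w : nat -> R) : (forall k, 0 <= a k) ->
  (\sum_(0 <= k <oo) (a k)%:E < +oo)%E ->
  (forall k, 0 <= w k) -> (forall k, w k.+1 <= w k + a k) ->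
  (forall (e : R) N, 0 < e -> exists2 k, (N <= k)%N & w k < e) ->
  w k @[k --> \oo] --> (0 : R).
Proof.
move=> a0 afin w0 wS wsmall; apply/cvgrPdist_le => e e0.
have e20 : 0 < e / 2 by rewrite divr_gt0.
have [N HN] := tail_sum_small a0 afin e20.
have [k Nk wk] := wsmall _ N e20.
exists k => // j /= kj; rewrite sub0r normrN ger0_norm//.
suff : w j <= w k + \sum_(k <= i < j) a i.
  by move=> /le_trans; apply; have := HN k j Nk; lra.
elim: j kj => [|j IH]; first by rewrite leqn0 => /eqP ->; rewrite big_geq// addr0.
rewrite leq_eqVlt => /predU1P[->|]; first by rewrite big_geq// addr0.
rewrite ltnS => kj; rewrite big_nat_recr//= addrA.
by apply: le_trans (wS j) _; rewrite lerD2r IH.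
Qed.

End Sequences.

(** * Local bounds, continuity and subgradients of convex functions *)

Section ConvexFunctions.
Variables (R : realType) (n : nat) (f : 'rV[R]_n -> R).
Hypothesis f_convex : @convex_function R 'rV[R]_n setT f.

Lemma convex_functionP (t : R) x y : 0 <= t -> t <= 1 ->
  f (t *: x + (1 - t) *: y) <= t * f x + (1 - t) * f y.
Proof.
by move=> t0 t1; apply: (f_convex (Itv01 t0 t1)); rewrite inE.
Qed.

(* One coordinate at a time: writing [u] as a midpoint splits off its last
   nonzero coordinate, at the price of doubling the box. *)
Lemma convex_bounded_above_coord k (r : R) : 0 < r ->
  exists M, forall u : 'rV[R]_n, (forall j, `|u ord0 j| <= r) ->
    (forall j : 'I_n, (k <= j)%N -> u ord0 j = 0) -> f u <= M.
Proof.
elim: k r => [|k IH] r r0.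
  exists (f 0) => u _ u0; suff -> : u = 0 by [].
  by apply/rowP => j; rewrite u0// mxE.
have [M HM] := IH (2 * r) (mulr_gt0 (ltr0Sn _ 1) r0).
have [kn|nk] := ltnP k n; last first.
  exists M => u ur _; apply: HM => [j|j kj].
    by apply: le_trans (ur j) _; lra.
  by have := ltn_ord j; rewrite ltnNge (leq_trans nk kj).
pose e : 'rV[R]_n := delta_mx ord0 (Ordinal kn).
(* Along the split-off axis, convexity bounds [f] by its larger value at the two ends of the doubled
   box. *)
pose A := Num.max (f ((2 * r) *: e)) (f (- (2 * r) *: e)).
exists (2^-1 * A + (1 - 2^-1) * M) => u ur u0.
pose c := u ord0 (Ordinal kn).
have /andP[cl cu] : - r <= c <= r by rewrite -ler_norml ur.
have -> : u = 2^-1 *: ((2 * c) *: e) + (1 - 2^-1) *: (2 *: (u - c *: e)).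
  by apply/rowP => j; rewrite !mxE; field.
apply: le_trans (convex_functionP _ _ _ _) _; [lra|lra|].
have hA : f ((2 * c) *: e) <= A.
  pose t := (c + r) / (2 * r).
  have t0 : 0 <= t by apply: divr_ge0; lra.
  have t1 : t <= 1 by rewrite ler_pdivrMr; lra.
  have -> : (2 * c) *: e = t *: ((2 * r) *: e) + (1 - t) *: (- (2 * r) *: e).
    by rewrite !scalerA -scalerDl; congr (_ *: _); rewrite /t; field; rewrite gt_eqF.
  apply: le_trans (convex_functionP _ _ t0 t1) _.
  have A1 : f ((2 * r) *: e) <= A by rewrite le_max lexx.
  have A2 : f (- (2 * r) *: e) <= A by rewrite le_max lexx orbT.
  nra.
have hM : f (2 *: (u - c *: e)) <= M.
  apply: HM => j; rewrite !mxE eqxx /=.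
    rewrite normrM (ger0_norm (ler0n _ 2)) ler_wpM2l//.
    have [->|_] := eqVneq j (Ordinal kn); last by rewrite mulr0 subr0.
    by rewrite mulr1 subrr normr0 ltW.
  rewrite leq_eqVlt => /predU1P[kj|kj].
    have -> : j = Ordinal kn by apply: val_inj.
    by rewrite eqxx mulr1 subrr mulr0.
  by rewrite -val_eqE /= gtn_eqF// mulr0 subr0 u0// mulr0.
lra.
Qed.

Lemma convex_bounded_above (r : R) : exists M, forall u, `|u| <= r -> f u <= M.
Proof.
have r0 : 0 < `|r| + 1 by rewrite ltr_pwDr.
have [M HM] := convex_bounded_above_coord n r0.
exists M => u ur; apply: HM => [j|j]; last by rewrite leqNgt ltn_ord.
apply: le_trans (coord_le_norm u j) (le_trans ur _).
by rewrite (le_trans (ler_norm r))// lerDl.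
Qed.

(** With [w] the unit vector along [h], [x + h] lies between [x] and [x + w], which bounds the
    increment above; [x] lies between [x - w] and [x + h], which bounds it below. *)
Lemma convex_locally_lipschitz x : exists2 K, 0 <= K &
  forall h, `|h| <= 1 -> `|f (x + h) - f x| <= K * `|h|.
Proof.
have [M HM] := convex_bounded_above (`|x| + 1).
have fxM : f x <= M by apply: HM; rewrite lerDl.
exists (M - f x); first by rewrite subr_ge0.
move=> h h1; have [->|h0] := eqVneq h 0; first by rewrite addr0 subrr !normr0 mulr0.
have t0 : 0 < `|h| by rewrite normr_gt0.
set t := `|h| in h1 t0 *; pose w := t^-1 *: h.
have w1 : `|w| = 1 by rewrite normrZ gtr0_norm ?invr_gt0// mulVf// gt_eqF.
have hE : h = t *: w by rewrite scalerA divff ?scale1r// gt_eqF.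
have up : f (x + w) <= M by apply: HM; rewrite (le_trans (ler_normD _ _))// w1.
have dn : f (x - w) <= M by apply: HM; rewrite (le_trans (ler_normB _ _))// w1.
have I1 := convex_functionP (x + w) x (ltW t0) h1.
have E1 : t *: (x + w) + (1 - t) *: x = x + h.
  by rewrite hE; apply/rowP => j; rewrite !mxE; ring.
pose s := (1 + t)^-1.
have s0 : 0 < s by rewrite invr_gt0; lra.
have s1 : s <= 1 by rewrite invf_le1; lra.
have I2 := convex_functionP (x + h) (x - w) (ltW s0) s1.
have E2 : s *: (x + h) + (1 - s) *: (x - w) = x.
  by rewrite hE; apply/rowP => j; rewrite !mxE /s; field; lra.
rewrite E1 in I1; rewrite E2 in I2.
have st : s * (1 + t) = 1 by rewrite mulVf//; lra.
have I3 : (1 + t) * f x <= f (x + h) + t * M.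
  have -> : f (x + h) + t * M = (1 + t) * (s * f (x + h) + (1 - s) * M).
    by rewrite /s; field; lra.
  by rewrite ler_wpM2l//; [lra|apply: le_trans I2 _; nra].
rewrite ler_norml; apply/andP; split; nra.
Qed.

Lemma convex_continuous : continuous f.
Proof.
move=> x; apply/(@cvgrPdist_le _ _ _ (nbhs x)) => e e0.
have [K K0 HK] := convex_locally_lipschitz x.
have d0 : 0 < Num.min 1 (e / (K + 1)).
  by rewrite lt_min ltr01 divr_gt0//; lra.
near=> y; have : `|x - y| < Num.min 1 (e / (K + 1)).
  by near: y; apply: cvgr_dist_lt d0; exact: cvg_id.
rewrite lt_min => /andP[y1 ye].
have := HK (y - x); rewrite (addrC x) subrK (distrC y) (distrC (f y)) => /(_ (ltW y1)).
move/le_trans; apply; move: ye; rewrite ltr_pdivlMr; last lra.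
by have := normr_ge0 (x - y); nra.
Unshelve. all: by end_near. Qed.

(** Testing the subgradient inequality at [v] plus or minus a basis vector bounds each coordinate of
    [d] by an increment of [f]. The value [f v] is bounded below because 0 is the midpoint of [v]
    and [- v]; this gives [2 * (M - f 0)]. *)
Lemma subgradients_bounded (r : R) : exists2 L, 0 <= L & forall v d,
  `|v| <= r -> subdifferential f v d -> dotv d d <= L.
Proof.
have [M HM] := convex_bounded_above (r + 1).
pose C := Num.max 0 (2 * (M - f 0)).
have C0 : 0 <= C by rewrite le_max lexx.
exists (n%:R * C ^+ 2) => [|v d vr dv]; first by rewrite mulr_ge0// sqr_ge0.
have fvM : f v <= M by apply: HM; lra.
have fNvM : f (- v) <= M by apply: HM; rewrite normrN; lra.
have lo : 2 * f 0 - M <= f v.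
  have := @convex_functionP 2^-1 v (- v); rewrite scalerN -scalerBl.
  rewrite (_ : 2^-1 - (1 - 2^-1) = 0 :> R); last by field.
  rewrite scale0r; move=> /(_ ltac:(lra) ltac:(lra)); lra.
apply: le_trans (dotvv_le_norm d) _; rewrite ler_wpM2l// ler_sqr ?nnegrE//.
apply: norm_le_coord => // j.
have step (s : R) : `|s| <= 1 -> s * d ord0 j <= C.
  move=> s1; have := dv (v + s *: delta_mx ord0 j).
  rewrite addrAC subrr add0r dotvZr {1}/dotv (bigD1 j)//= big1 => [|i ij]; last first.
    by rewrite mxE (negbTE ij) andbF mulr0.
  rewrite mxE !eqxx mulr1 addr0.
  have : f (v + s *: delta_mx ord0 j) <= M.
    apply: HM; apply: le_trans (ler_normD _ _) _; rewrite lerD//.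
    rewrite normrZ mulr_ile1// norm_le_coord// => i.
    by rewrite mxE normr_nat lern1 leq_b1.
  have : 2 * (M - f 0) <= C by rewrite le_max lexx orbT.
  lra.
rewrite ler_norml -lerNl -mulN1r -{2}(mul1r (d _ _)).
by rewrite !step// ?normrN normr1.
Qed.

End ConvexFunctions.

(** * Convex sets and Euclidean projection *)

Section ConvexSets.
Variables (R : realType) (n : nat).
Implicit Types (C : set 'rV[R]_n) (x y z p v : 'rV[R]_n).

Lemma convex_setP C (t : R) x y : @convex_set R 'rV[R]_n C ->
  0 <= t -> t <= 1 -> C x -> C y -> C (t *: x + (1 - t) *: y).
Proof.
move=> Cconv t0 t1 Cx Cy; apply: set_mem.
by apply: (Cconv x y (Itv01 t0 t1)); exact: mem_set.
Qed.

Lemma closed_bounded_compact C (B : R) : closed C ->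
  (forall y, C y -> enorm y <= B) -> compact C.
Proof.
move=> Ccl CB; apply: bounded_closed_compact => //.
exists B; split; first exact: num_real.
move=> M BM y /CB yB; apply: ltW; apply: le_lt_trans BM.
have B0 : 0 <= B by apply: le_trans yB; rewrite sqrtr_ge0.
by apply: norm_le_dotvv => //; rewrite -enorm_le.
Qed.

Lemma continuous_sqdist z : continuous (fun p => dotv (z - p) (z - p)).
Proof.
move=> p; apply: (@cvg_big _ _ _ _ _ _ _ (nbhs p)) => [|j _].
  exact: add_continuous.
have cj : (fun q : 'rV[R]_n => z ord0 j - q ord0 j) @ nbhs p -->
    z ord0 j - p ord0 j.
  by apply: cvgB; [exact: cvg_cst | exact: coord_continuous].
rewrite (_ : (fun _ => _) =
    fun q : 'rV[R]_n => (z ord0 j - q ord0 j) * (z ord0 j - q ord0 j)); last first.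
  by apply/funext => q; rewrite !mxE.
by rewrite !mxE; exact: cvgM.
Qed.

(** Minimizing the continuous squared distance over a compact set yields a nearest point, so [xget]
    does not return its default. *)
Lemma projP C z : compact C -> C !=set0 ->
  C (proj C z) /\ forall q, C q -> enorm (z - proj C z) <= enorm (z - q).
Proof.
move=> Ccpt C0.
have [|p Cp pmin] := compact_EVT_min C0 Ccpt (f := fun p => dotv (z - p) (z - p)).
  exact/continuous_subspaceT/continuous_sqdist.
suff : [set p | C p /\ forall q, C q -> enorm (z - p) <= enorm (z - q)] p.
  exact: xgetI.
by split=> [|q Cq]; [exact: set_mem | rewrite ler_enorm pmin// mem_set].
Qed.

Lemma proj_closer C z q : @convex_set R 'rV[R]_n C -> compact C -> C q ->
  dotv (proj C z - q) (proj C z - q) <= dotv (z - q) (z - q).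
Proof.
move=> Cconv Ccpt Cq; have C0 : C !=set0 by exists q.
have [] := projP z Ccpt C0; set p := proj C z => Cp pmin.
have bE : dotv (z - q) (z - q) =
    dotv (z - p) (z - p) - 2 * dotv (z - p) (q - p) + dotv (q - p) (q - p).
  by rewrite -dotvvB opprB addrA subrK.
rewrite bE dotvvN; have := dotvv_ge0 (z - p); have := dotvv_ge0 (q - p).
(* Minimality of [p] against the points of the segment from [p] to [q]; small [t] will force the
   obtuse angle [dotv (z - p) (q - p) <= 0]. *)
move: bE => _; have : forall t, 0 <= t -> t <= 1 ->
    2 * t * dotv (z - p) (q - p) <= t ^+ 2 * dotv (q - p) (q - p).
  move=> t t0 t1; have := pmin _ (convex_setP Cconv t0 t1 Cq Cp).
  rewrite ler_enorm (_ : z - (_ + _) = (z - p) + (- t) *: (q - p)); last first.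
    by apply/rowP => j; rewrite !mxE; ring.
  by rewrite dotvvDZ; lra.
set a := dotv (z - p) (q - p); set b := dotv (q - p) (q - p); set c := dotv _ _.
move=> var b0 c0; suff : a <= 0 by lra.
rewrite leNgt; apply/negP => a0.
have ab0 : 0 < a + b by lra.
(* This [t] satisfies [t * b <= a], so [var] divided by [t] would give [2 * a <= a]. *)
have t0 : 0 < a / (a + b) by apply: divr_gt0.
have t1 : a / (a + b) <= 1 by rewrite ler_pdivrMr//; lra.
have := var _ (ltW t0) t1.
have : a / (a + b) * (a + b) = a by rewrite divfK// gt_eqF.
by set t := a / (a + b) in t0 t1 *; nra.
Qed.

(* The point is also a convex combination of [p] and of
   [xbar + (delta / e) *: (v - p)], which lies in the ball around [xbar]. *)
Lemma contraction_in_convex C xbar v p (delta e : R) :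
  @convex_set R 'rV[R]_n C -> 0 < delta -> 0 <= e ->
  (forall z, enorm (z - xbar) <= delta -> C z) ->
  C p -> dotv (p - v) (p - v) <= e ^+ 2 ->
  C ((e / (e + delta)) *: xbar + (1 - e / (e + delta)) *: v).
Proof.
move=> Cconv d0 e0 ball Cp pv.
(* The factor [delta / e] calls for [e != 0]; when [e = 0] the bound forces [v = p]. *)
have [ez|en0] := eqVneq e 0.
  move: pv; rewrite ez mul0r scale0r add0r subr0 scale1r => pv.
  have /normr0_eq0/subr0_eq <- : `|p - v| = 0.
    by apply: le_anti; rewrite normr_ge0 andbT norm_le_dotvv.
  by [].
have ep : 0 < e by rewrite lt_neqAle eq_sym en0.
have t0 : 0 <= e / (e + delta) by rewrite divr_ge0//; lra.
have t1 : e / (e + delta) <= 1 by rewrite ler_pdivrMr; lra.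
have -> : (e / (e + delta)) *: xbar + (1 - e / (e + delta)) *: v =
    (e / (e + delta)) *: (xbar + (delta / e) *: (v - p)) +
    (1 - e / (e + delta)) *: p.
  apply/rowP => j; rewrite !mxE; field.
  by rewrite en0 /= gt_eqF//; lra.
apply: convex_setP => //; apply: ball.
rewrite addrAC subrr add0r enorm_le ?(ltW d0)// dotvvZ dotvvN.
rewrite (_ : delta ^+ 2 = (delta / e) ^+ 2 * e ^+ 2); last by field.
by rewrite ler_wpM2l// sqr_ge0.
Qed.

End ConvexSets.

(** * Estimates for one iteration *)

Lemma projected_subgradient_step (R : realType) (n : nat) (f : 'rV[R]_n -> R)
    (C : set 'rV[R]_n) (alpha : R) (v d z : 'rV[R]_n) :
  @convex_set R 'rV[R]_n C -> compact C -> C z -> 0 <= alpha ->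
  subdifferential f v d ->
  dotv (proj C (v - alpha *: d) - z) (proj C (v - alpha *: d) - z) <=
  dotv (v - z) (v - z) - 2 * alpha * (f v - f z) + alpha ^+ 2 * dotv d d.
Proof.
move=> Cconv Ccpt Cz alpha0 dsub; have dv := dsub z.
apply: le_trans (proj_closer _ Cconv Ccpt Cz) _.
have -> : v - alpha *: d - z = (v - z) + (- alpha) *: d.
  by apply/rowP => j; rewrite !mxE; ring.
(* The cross term of the expanded square is controlled by the subgradient inequality tested at
   [z]. *)
move: dv; rewrite dotvvDZ sqrrN lerD2r lerD2l -(opprB v z) -scaleN1r dotvZr.
by rewrite (dotvC d) => dv; nra.
Qed.

(* Convexity on the segment from [y] to [xbar] replaces any Lipschitz estimate here. *)
Lemma infeasible_lower_bound (R : realType) (n : nat) (F : 'rV[R]_n -> R)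
    (X : set 'rV[R]_n) (z xbar y : 'rV[R]_n) (delta e : R) :
  (forall t u w, 0 <= t -> t <= 1 ->
    F (t *: u + (1 - t) *: w) <= t * F u + (1 - t) * F w) ->
  (forall u, X u -> F z <= F u) -> 0 < delta -> 0 <= e ->
  X ((e / (e + delta)) *: xbar + (1 - e / (e + delta)) *: y) ->
  F z - (F xbar - F z) / delta * e <= F y.
Proof.
move=> Fconv zmin d0 e0 Xs.
have t0 : 0 <= e / (e + delta) by rewrite divr_ge0//; lra.
have t1 : e / (e + delta) <= 1 by rewrite ler_pdivrMr; lra.
have := le_trans (zmin _ Xs) (Fconv _ _ _ t0 t1).
(* The factor is the inverse of the weight of [y], so that [F y] appears with coefficient 1. *)
rewrite -(ler_pM2l (_ : 0 < (e + delta) / delta)); last by rewrite divr_gt0//; lra.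
have -> : (e + delta) / delta *
    (e / (e + delta) * F xbar + (1 - e / (e + delta)) * F y) =
    e / delta * F xbar + F y by field; rewrite !gt_eqF//; lra.
have -> : (e + delta) / delta * F z = F z + e / delta * F z.
  by field; rewrite gt_eqF.
by rewrite mulrAC mulrC; lra.
Qed.

Lemma frequent_cluster_point (R : realType) (T : topologicalType) (K : set T)
    (y : nat -> T) (g : nat -> R) :
  compact K -> (forall k, K (y k)) ->
  (forall (e : R) N, 0 < e -> exists2 k, (N <= k)%N & g k < e) ->
  exists x : T, forall U, nbhs x U -> forall (e : R) N, 0 < e ->
    exists k, [/\ (N <= k)%N, U (y k) & g k < e].
Proof.
move=> Kcpt Ky gsmall.
(* Compactness is applied along indices [phi p] where [g] tends to 0, so that nearness and smallness
   hold at the same index. *)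
have /choice[phi phiP] p : exists k, (p <= k)%N /\ g k < p.+1%:R^-1 :> R.
  by have [|k pk gk] := gsmall p.+1%:R^-1 p; [rewrite invr_gt0 | exists k].
have [|x [_ xcl]] := Kcpt ((y \o phi) @ \oo) _.
  by exists 0%N => // k _; exact: Ky.
exists x => U Ux e N e0.
pose M := maxn N (Num.truncn e^-1).
have tailM : ((y \o phi) @ \oo) ((y \o phi) @` [set p | (M <= p)%N]).
  by exists M => // p Mp; exists p.
have [_ [[p /= Mp <-] Up]] := xcl _ _ tailM Ux.
have [pphi gphi] := phiP p.
exists (phi p); split => //.
  by rewrite (leq_trans _ pphi)// (leq_trans _ Mp)// leq_maxl.
apply: lt_le_trans gphi _; rewrite invf_ple ?posrE//.
apply: le_trans (ltW (truncnS_gt _)) _.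
by rewrite ler_nat ltnS (leq_trans _ Mp)// leq_maxr.
Qed.

(** * Convergence of the iterates to a common minimizer *)

Theorem proposition5 (R : realType) (n m : nat)
    (f : 'I_m -> 'rV[R]_n -> R)
    (X : 'I_m -> set 'rV[R]_n)
    (f_convex : forall i : 'I_m, @convex_function R 'rV[R]_n setT (f i))
    (X_closed : forall i : 'I_m, closed (X i))
    (X_convex : forall i : 'I_m, @convex_set R 'rV[R]_n (X i))
    (xbar : 'rV[R]_n) (delta : R)
    (delta_gt0 : 0 < delta)
    (ball_sub : [set z : 'rV[R]_n | enorm (z - xbar) <= delta]
                  `<=` \bigcap_(i in [set: 'I_m]) X i)
    (B : R) (B_gt0 : 0 < B)
    (X_bounded : forall (i : 'I_m) (y : 'rV[R]_n), X i y -> enorm y <= B)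
    (a : 'I_m -> nat -> 'I_m -> R)
    (a_unif : forall (i : 'I_m) (k : nat) (j : 'I_m), a i k j = 1 / m%:R)
    (alpha : nat -> R)
    (alpha_gt0 : forall k : nat, 0 < alpha k)
    (alpha_sum : (\sum_(0 <= k <oo) (alpha k)%:E = +oo)%E)
    (alpha_sqsum : (\sum_(0 <= k <oo) (alpha k ^+ 2)%:E < +oo)%E)
    (x v d : 'I_m -> nat -> 'rV[R]_n)
    (x_init : forall i : 'I_m, X i (x i 0%N))
    (v_def : forall (i : 'I_m) (k : nat),
        v i k = \sum_(j < m) a i k j *: x j k)
    (d_subgrad : forall (i : 'I_m) (k : nat),
        subdifferential (f i) (v i k) (d i k))
    (x_step : forall (i : 'I_m) (k : nat),
        x i k.+1 = proj (X i) (v i k - alpha k *: d i k)) :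
  exists xstar : 'rV[R]_n,
    minimizers (fun y : 'rV[R]_n => \sum_(i < m) f i y)
               (\bigcap_(i in [set: 'I_m]) X i) xstar /\
    forall i : 'I_m, x i k @[k --> \oo] --> xstar.
Proof.
(* Without agents the objective is an empty sum and every vector is optimal. *)
have [m0|m_neq0] := eqVneq m 0%N.
  have no (i : 'I_m) : False by have := ltn_ord i; rewrite {2}m0.
  exists 0; split=> [|i]; last by case: (no i).
  split=> [i|u _]; first by case: (no i).
  by rewrite !big1// => i; case: (no i).
have m_gt0 : 0 < m%:R :> R by rewrite ltr0n lt0n.
pose i0 : 'I_m := Ordinal (etrans (lt0n m) m_neq0).
pose XX := \bigcap_(i in [set: 'I_m]) X i.
have XXi z i : XX z -> X i z by apply.
have Xcpt i : compact (X i) by exact: closed_bounded_compact (X_bounded i).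
have XX_closed : closed XX by apply: closed_bigI => i _.
have XX_cpt : compact XX.
  by apply: subclosed_compact XX_closed (Xcpt i0) _ => z /XXi.
have XX_xbar : XX xbar.
  by apply: ball_sub; rewrite /= subrr enormE dotv0r sqrtr0 ltW.
have X_x i k : X i (x i k).
  case: k => // k; rewrite x_step.
  by apply: (projP _ (Xcpt i) _).1; exists xbar; exact: XXi.
pose y k := m%:R^-1 *: \sum_j x j k.
have vE i k : v i k = y k.
  rewrite v_def /y scaler_sumr; apply: eq_bigr => j _.
  by rewrite a_unif mul1r.
have yE k : m%:R *: y k = \sum_j x j k.
  by rewrite /y scalerA divff ?scale1r// gt_eqF.
have y_bounded k : `|y k| <= B.
  rewrite -(ler_pM2l m_gt0) -{1}(gtr0_norm m_gt0) -normrZ yE.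
  apply: le_trans (ler_norm_sum _ _ _) _.
  rewrite -[X in X%:R * _]card_ord mulr_natl -sumr_const ler_sum// => i _.
  by apply: norm_le_dotvv (ltW B_gt0) _; rewrite -enorm_le ?(ltW B_gt0)// (X_bounded i).
pose F z := \sum_i f i z.
have F_conv t u w : 0 <= t -> t <= 1 ->
    F (t *: u + (1 - t) *: w) <= t * F u + (1 - t) * F w.
  move=> t0 t1; rewrite /F !mulr_sumr -big_split ler_sum// => i _.
  exact: convex_functionP.
have F_cont : continuous F.
  move=> z; apply: (@cvg_big _ _ _ _ _ _ _ (nbhs z)) => [|i _].
    exact: add_continuous.
  exact: (convex_continuous (f_convex i)).
(* A reference minimizer, used until the actual limit [xs] is available. *)
have [zmin /set_mem XXzmin zminP] :
    exists2 c, c \in XX & forall t, t \in XX -> F c <= F t.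
  apply: compact_EVT_min => //; first by exists xbar.
  exact: continuous_subspaceT.
have zmin_le u : XX u -> F zmin <= F u by move=> XXu; apply: zminP; exact: mem_set.
have [L L0 dL] : exists2 L, 0 <= L & forall k, \sum_i dotv (d i k) (d i k) <= L.
  have /choice[Li LiP] i : exists L, 0 <= L /\ forall v d,
      `|v| <= B -> subdifferential (f i) v d -> dotv d d <= L.
    by have [L L0 LP] := subgradients_bounded (f_convex i) B; exists L.
  exists (\sum_i Li i); first by apply: sumr_ge0 => i _; have [] := LiP i.
  move=> k; apply: ler_sum => i _; have [_] := LiP i; apply; last first.
    exact: d_subgrad.
  by rewrite vE.
have [S S0 SP] := partial_sum_le (fun k => sqr_ge0 (alpha k)) alpha_sqsum.
(* Bounds the stepsizes, since [2 * alpha k <= 1 + alpha k ^+ 2 <= 1 + S]. *)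
pose A := 1 + S.
have A_gt0 : 0 < A by rewrite /A; lra.
have alpha_le k : alpha k <= A.
  have := SP k.+1; rewrite big_nat_recr//= => Sk.
  have : 0 <= \sum_(0 <= i < k) alpha i ^+ 2.
    by apply: sumr_ge0 => i _; exact: sqr_ge0.
  by have := sqr_ge0 (alpha k - 1); rewrite /A; lra.
pose W z k := \sum_i dotv (x i k - z) (x i k - z).
pose V k := \sum_i dotv (x i k - y k) (x i k - y k).
have W_ge i z k : dotv (x i k - z) (x i k - z) <= W z k.
  by rewrite /W (bigD1 i)//= lerDl sumr_ge0// => j _; exact: dotvv_ge0.
have W_ge0 z k : 0 <= W z k by exact: le_trans (dotvv_ge0 _) (W_ge i0 z k).
have V_ge0 k : 0 <= V k by exact: (W_ge0 (y k) k).
have WE z k : W z k = m%:R * dotv (y k - z) (y k - z) + V k.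
  exact: sum_dotvv_mean.
pose eps k := Num.sqrt (V k).
have eps_ge0 k : 0 <= eps k by exact: sqrtr_ge0.
have eps_sq k : eps k ^+ 2 = V k by exact: sqr_sqrtr.
pose C := (F xbar - F zmin) / delta.
have C_ge0 : 0 <= C.
  by rewrite divr_ge0 ?(ltW delta_gt0)// subr_ge0 zmin_le.
(* The objective gap at [y k], shifted by the possible infeasibility deficit to become
   nonnegative. *)
pose g k := F (y k) - F zmin + C * eps k.
have g_ge0 k : 0 <= g k.
  have : F zmin - C * eps k <= F (y k).
    apply: (infeasible_lower_bound F_conv zmin_le delta_gt0 (eps_ge0 k)).
    move=> i _; apply: (@contraction_in_convex _ _ _ _ _ (x i k)) => //.
    - by move=> z zball; apply/XXi/ball_sub.
    - by rewrite eps_sq; exact: W_ge.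
  by rewrite /g; lra.
(* As [alpha k <= A], the first term times [alpha k] costs at most [V k / 2]; the other half of
   [V k] pays for the cross term, up to the [2 * C ^+ 2] in [c]. *)
pose G k := V k / (2 * A) + 2 * g k.
pose c := L + 2 * C ^+ 2.
have c_ge0 : 0 <= c by rewrite addr_ge0// mulr_ge0// sqr_ge0.
have G_ge0 k : 0 <= G k.
  by apply: addr_ge0; [apply: divr_ge0 => //; lra | exact: mulr_ge0].
(* Stated for every minimizer, as it serves first for [zmin] and then for [xs]. *)
have descent z k : XX z -> F z = F zmin ->
    W z k.+1 <= W z k - alpha k * G k + c * alpha k ^+ 2.
  move=> XXz Fz.
  have step : W z k.+1 <=
      W z k - V k - 2 * alpha k * (F (y k) - F zmin) + L * alpha k ^+ 2.
    (* All agents start from the same [y k], so their one-step bounds add up from [m |y k - z|^2],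
       which is [W z k - V k]. *)
    rewrite (WE z k) addrK.
    have -> : m%:R * dotv (y k - z) (y k - z) = \sum_(i < m) dotv (y k - z) (y k - z).
      by rewrite sumr_const card_ord mulr_natl.
    have -> : F (y k) - F zmin = \sum_i (f i (y k) - f i z).
      by rewrite -Fz /F sumrB.
    have dLk : (\sum_i dotv (d i k) (d i k)) * alpha k ^+ 2 <= L * alpha k ^+ 2.
      by rewrite ler_wpM2r// sqr_ge0.
    apply: le_trans (lerD (lexx _) dLk).
    rewrite mulr_sumr mulr_suml -sumrB -big_split ler_sum// => i _ /=.
    rewrite x_step -(vE i k) (mulrC (dotv (d i k) _)).
    apply: projected_subgradient_step => //; first exact: XXi.
    exact: ltW.
  have VG : alpha k * (V k / (2 * A)) <= V k / 2.
    rewrite mulrCA ler_wpM2l// ler_pdivrMr ?mulr_gt0//.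
    by rewrite mulrA mulVf// mul1r.
  (* AM-GM absorbs the cross term [2 alpha C eps] into [V / 2 = eps^2 / 2]. *)
  have := sqr_ge0 (eps k - 2 * C * alpha k).
  rewrite sqrrB exprMn eps_sq => amgm.
  move: step; rewrite /G /g /c mulrDr; lra.
have G_small (e : R) N : 0 < e -> exists2 k, (N <= k)%N & G k < e.
  apply: (@weighted_sum_frequently_small _ alpha G (W zmin 0%N + c * S)) => //.
  - by move=> k; exact: ltW.
  - by apply: partial_sum_unbounded => // k; exact: ltW.
  move=> K.
  (* [descent] telescopes, and [W] is nonnegative. *)
  suff : W zmin K + \sum_(0 <= k < K) alpha k * G k <=
      W zmin 0%N + c * \sum_(0 <= k < K) alpha k ^+ 2.
    have := W_ge0 zmin K; have := ler_wpM2l c_ge0 (SP K); lra.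
  elim: K => [|K IH]; first by rewrite !big_geq// mulr0 addr0.
  by rewrite !big_nat_recr//= (mulrDr c); have := descent zmin K XXzmin erefl; lra.
pose K := [set u : 'rV[R]_n | `|u| <= B].
have K_cpt : compact K.
  apply: bounded_closed_compact.
    by exists B; split=> [|M BM u uB]; [exact: num_real | exact: le_trans (ltW BM)].
  rewrite (_ : K = closed_ball_ Num.Def.normr 0 B); last first.
    by apply/seteqP; split=> u; rewrite /closed_ball_ /= sub0r normrN.
  exact: closed_closed_ball_.
have [xs xsP] := frequent_cluster_point K_cpt y_bounded G_small.
have V_le k : V k <= 2 * A * G k.
  by rewrite mulrC -ler_pdivrMr ?mulr_gt0// lerDl mulr_ge0.
have g_le k : 2 * g k <= G k by rewrite lerDr divr_ge0 ?mulr_ge0 ?(ltW A_gt0).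
have XXxs : XX xs.
  move=> i _; apply: X_closed => U /nbhs_ballP[r /= r0 rU].
  have r20 : 0 < r / 2 by rewrite divr_gt0.
  (* Below this threshold for [G k], [V k] is less than [(r / 2) ^+ 2], so [x i k] is within [r / 2]
     of [y k]. *)
  have e0 : 0 < (r / 2) ^+ 2 / (2 * A) by rewrite divr_gt0 ?exprn_gt0 ?mulr_gt0.
  have [k [_ yk Gk]] := xsP _ (nbhsx_ballx xs _ r20) _ 0%N e0.
  exists (x i k); split; first exact: X_x.
  apply: rU; rewrite -ball_normE /=; move: yk; rewrite -ball_normE /= => yk.
  rewrite -(subrKA (y k)); apply: le_lt_trans (ler_normD _ _) _.
  suff : `|y k - x i k| <= r / 2 by lra.
  rewrite distrC; apply: norm_le_dotvv (ltW r20) _.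
  apply: le_trans (W_ge i (y k) k) (le_trans (V_le k) _).
  by move: Gk; rewrite ltr_pdivlMr ?mulr_gt0// mulrC => /ltW.
have Fxs : F xs = F zmin.
  apply/eqP; rewrite eq_le zmin_le// andbT leNgt; apply/negP => Flt.
  (* By continuity [F (y k) - F zmin] exceeds half the gap, while [G k] below the gap keeps it under
     that half. *)
  have Unbhs : \forall u \near xs, F zmin + (F xs - F zmin) / 2 < F u.
    apply: (cvgr_gt _ (F_cont xs)); lra.
  have e0 : 0 < F xs - F zmin by lra.
  have [k [_ yk Gk]] := xsP _ Unbhs _ 0%N e0.
  have := g_le k; have := mulr_ge0 C_ge0 (eps_ge0 k); rewrite /g.
  by move: yk => /=; lra.
have W_cvg : W xs k @[k --> \oo] --> (0 : R).
  apply: (@quasi_decreasing_cvg0 _ (fun k => c * alpha k ^+ 2)) => //.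
  - by move=> k; rewrite mulr_ge0// sqr_ge0.
  - under eq_eseriesr do rewrite EFinM.
    rewrite nneseriesZl => [|k _]; last by rewrite lee_fin sqr_ge0.
    by rewrite lte_mul_pinfty.
  - move=> k; apply: le_trans (descent xs k XXxs Fxs) _.
    by have := mulr_ge0 (ltW (alpha_gt0 k)) (G_ge0 k); lra.
  move=> e N e0.
  (* The two thresholds put each summand of [WE], [m |y k - xs|^2] and [V k], below [e / 2]. *)
  have em0 : 0 < e / 2 / m%:R by rewrite !divr_gt0.
  have Unbhs : \forall u \near xs, dotv (xs - u) (xs - u) < e / 2 / m%:R.
    by apply: (cvgr_lt _ (@continuous_sqdist _ _ xs xs)); rewrite subrr dotv0r.
  have eA0 : 0 < e / 2 / (2 * A) by rewrite !divr_gt0 ?mulr_gt0.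
  have [k [Nk yk Gk]] := xsP _ Unbhs _ N eA0.
  exists k => //; rewrite WE dotvvN.
  move: yk => /=; rewrite ltr_pdivlMr// => yk.
  move: Gk; rewrite ltr_pdivlMr ?mulr_gt0// => Gk.
  by have := V_le k; lra.
exists xs; split.
  by split=> // u XXu; rewrite -/(F xs) Fxs zmin_le.
move=> i; apply/cvgrPdist_le => e e0.
have e20 : 0 < e ^+ 2 by rewrite exprn_gt0.
have [N _ HN] := cvgr_lt _ W_cvg _ e20.
exists N => // k /HN /= Wk; rewrite distrC.
apply: norm_le_dotvv (ltW e0) _.
exact: le_trans (W_ge i xs k) (ltW Wk).
Qed.
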